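(* Let $\rho \in \mathbb{R}^m$ be given by $$\rho^k = m \cdot \max_{i \in I} \Big( \max_{x_i \in X_i} H_i^k x_i - \min_{x_i \in X_i} H_i^k x_i \Big), \qquad k = 1,\dots,m,$$ and let $\bar b = b - \rho$. Assume that the programs $\overline{\mathcal{P}}_{\mathrm{LP}}$ and $\overline{\mathcal{D}}$ (the convexified program and the dual program with resource vector $\bar b$) each have a unique optimal solution, and let $\bar\lambda^\star$ be the optimal solution of $\overline{\mathcal{D}}$. Then any selection $x(\bar\lambda^\star) \in \mathcal{X}(\bar\lambda^\star)$ is feasible for $\mathcal{P}$, i.e. $x_i(\bar\lambda^\star) \in X_i$ for all $i\in I$ and $\sum_{i \in I} H_i x_i(\bar\lambda^\star) \preceq b$.
   Context: Let $I$ be a finite index set and $m$ a positive integer with $|I| > m$. For each $i \in I$ let $r_i, z_i$ be nonnegative integers, $n_i = r_i + z_i$, $c_i \in \mathbb{R}^{n_i}$, $H_i \in \mathbb{R}^{m \times n_i}$, and let $X_i = \{x \in \mathbb{R}^{r_i} \times \mathbb{Z}^{z_i} : A_i x \preceq d_i\}$ (with $A_i \in \mathbb{R}^{m_i \times n_i}$, $d_i \in \mathbb{R}^{m_i}$) be non-empty and compact. Let $b \in \mathbb{R}^m$. Inequalities $\preceq, \succeq$ between vectors are componentwise; $H_i^k$ is the $k$-th row of $H_i$. The mixed-integer program $\mathcal{P}$ is: minimize $\sum_{i\in I} c_i^\top x_i$ subject to $\sum_{i \in I} H_i x_i \preceq b$ and $x_i \in X_i$ for all $i \in I$; it is assumed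 to be feasible. The program $\overline{\mathcal{P}}_{\mathrm{LP}}$ is: minimize $\sum_{i\in I} c_i^\top x_i$ subject to $\sum_{i \in I} H_i x_i \preceq \bar b$ and $x_i \in \mathrm{conv}(X_i)$ for all $i \in I$. The dual problem $\overline{\mathcal{D}}$ is: maximize over $\lambda \in \mathbb{R}^m$, $\lambda \succeq 0$, the function $-\lambda^\top \bar b + \sum_{i \in I} \min_{x_i \in X_i} (c_i^\top x_i + \lambda^\top H_i x_i)$. Let $\mathrm{vert}(X_i)$ denote the set of vertices of $\mathrm{conv}(X_i)$. For $\lambda \succeq 0$ put $\mathcal{X}_i(\lambda) = \mathrm{vert}(X_i) \cap \arg\min_{x_i \in X_i} (c_i^\top x_i + \lambda^\top H_i x_i)$ and $\mathcal{X}(\lambda) = \prod_{i\in I} \mathcal{X}_i(\lambda)$; a selection $x(\lambda) = (x_i(\lambda))_{i \in I}$ is any element of $\mathcal{X}(\lambda)$. *)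

(* Defs.v *)
From mathcomp Require Import all_boot all_order all_algebra.
From mathcomp Require Import all_classical all_reals all_analysis.

Set Implicit Arguments.
Unset Strict Implicit.
Unset Printing Implicit Defensive.

Import Order.TTheory GRing.Theory Num.Theory.
Import numFieldNormedType.Exports.

Local Open Scope classical_set_scope.
Local Open Scope ring_scope.

Section VectorsAndSets.
Context {R : realType}.

Definition lev n (u v : 'cV[R]_n) : Prop := forall k, u k 0 <= v k 0.

Definition dot n (u v : 'cV[R]_n) : R := (u^T *m v) 0 0.

Definition conv_hull n (X : set 'cV[R]_n) : set 'cV[R]_n :=
  smallest (@convex_set R 'cV[R]_n) X.

Definition extreme_points n (C : set 'cV[R]_n) : set 'cV[R]_n :=
  [set v | C v /\ forall (x y : 'cV[R]_n) (t : R), C x -> C y ->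
     0 < t < 1 -> v = t *: x + (1 - t) *: y -> x = v /\ y = v].

(* vert(X) is the set of vertices of conv(X), not of X; when X is a compact
   mixed-integer set, conv(X) is a polytope, whose vertices are its extreme
   points. *)
Definition vert n (X : set 'cV[R]_n) : set 'cV[R]_n :=
  extreme_points (conv_hull X).

Definition argmin (T : Type) (S : set T) (f : T -> R) : set T :=
  [set x | S x /\ forall y, S y -> f x <= f y].

Definition argmax (T : Type) (S : set T) (f : T -> R) : set T :=
  [set x | S x /\ forall y, S y -> f y <= f x].

End VectorsAndSets.

(* minimize \sum_i c_i^T x_i subject to \sum_i H_i x_i <= b, A_i x_i <= d_i and
   x_i in R^(nreal i) x Z^(nint i); c, H, A, d, b are obj, coupling, lhs, rhs
   and resource. *)
Record milp (R : realType) (I : finType) (m : nat) := Milp {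
  nreal : I -> nat;
  nint : I -> nat;
  nrows : I -> nat;
  obj : forall i, 'cV[R]_(nreal i + nint i);
  coupling : forall i, 'M[R]_(m, nreal i + nint i);
  lhs : forall i, 'M[R]_(nrows i, nreal i + nint i);
  rhs : forall i, 'cV[R]_(nrows i);
  resource : 'cV[R]_m
}.

Unset Implicit Arguments.

Section Programs.
Context {R : realType} {I : finType} {m : nat}.
Implicit Types (P : milp R I m) (u lambda : 'cV[R]_m).

Local Notation vec P i := 'cV[R]_(nreal P i + nint P i).

(* The last nint P i coordinates are the integer ones. *)
Definition local_set P (i : I) : set (vec P i) :=
  [set x : vec P i |
    (forall j : 'I_(nint P i), x (rshift (nreal P i) j) 0 \is a Num.int)
    /\ lev (lhs P i *m x) (rhs P i)].

Definition cost P (x : forall i, vec P i) : R :=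
  \sum_i dot (obj P i) (x i).

Definition usage P (x : forall i, vec P i) : 'cV[R]_m :=
  \sum_i coupling P i *m x i.

Definition feasible P : set (forall i, vec P i) :=
  [set x : forall i, vec P i |
    lev (usage P x) (resource P) /\ forall i, local_set P i (x i)].

(* In the convexified program and in the dual, u is the resource vector that
   replaces the one of P. *)
Definition lp_feasible P u : set (forall i, vec P i) :=
  [set x : forall i, vec P i |
    lev (usage P x) u /\ forall i, conv_hull (local_set P i) (x i)].

Definition lp_optimal P u : set (forall i, vec P i) :=
  argmin (lp_feasible P u) (cost P).

Definition lagrangian P lambda (i : I) (x : vec P i) : R :=
  dot (obj P i) x + dot lambda (coupling P i *m x).

(* The minima and maxima below are of linear functions over the sets X_i,
   which the theorem assumes nonempty and compact, so that they are attained
   and equal to inf and sup; likewise for the maximum over the nonempty finite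
   index set I in rho. *)
Definition dual_function P u lambda : R :=
  - dot lambda u
  + \sum_i inf [set lagrangian P lambda i x | x in local_set P i].

Definition dual_optimal P u : set 'cV[R]_m :=
  argmax [set lambda | lev 0 lambda] (dual_function P u).

Definition coupling_range P (k : 'I_m) (i : I) : R :=
  let S := [set (row k (coupling P i) *m x) 0 0 | x in local_set P i] in
  sup S - inf S.

Definition rho P : 'cV[R]_m :=
  \col_k (m%:R * sup [set coupling_range P k i | i in [set: I]]).

Definition selections P lambda : set (forall i, vec P i) :=
  [set x : forall i, vec P i |
    forall i, (vert (local_set P i)
               `&` argmin (local_set P i) (lagrangian P lambda i)) (x i)].

End Programs.

(* Main.v *)
From HB Require Import structures.
Require Import Defs.
From mathcomp Require Import all_boot all_order all_algebra.
From mathcomp Require Import all_classical all_reals all_analysis.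
From mathcomp Require Import ring lra.

(** Write u for the contracted resource vector b - rho, l for the dual optimum
    and x for a selection at l. The selection may violate the contracted
    constraint, but only because of the blocks where it differs from the
    optimum xbar of the convexified program. If at most m blocks differ, the
    excess in row k is at most m times the largest range of a block in that
    row, which is rho^k: the contraction pays for it exactly.

    That at most m blocks differ rests on the two uniqueness hypotheses, through
    strict complementarity [strict_complementarity]: xbar can be written
    xbar = e x + (1 - e) y with 0 < e <= 1, where each y_i, like each x_i,
    minimizes the Lagrangian at l over conv(X_i). Every block of xbar can
    therefore be pushed a little along x_i - xbar_i, in either direction,
    within the set of Lagrangian minimizers. If more than m blocks differed,
    the vectors H_i (x_i - xbar_i) of R^m would be linearly dependent; a small
    push of xbar with the coefficients of a dependence keeps the resource usage,
    hence feasibility and complementary slackness, hence optimality, and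
    contradicts the uniqueness of xbar [card_moved_blocks_le].

    The decomposition of xbar comes from the uniqueness of l by the lemma of
    Farkas [farkas]. The cone generated by the vectors (usage v - u), for v in a
    finite set of Lagrangian-minimal points, and by the unit vectors e_k with
    l_k = 0, contains u - usage x: otherwise a separating direction d is
    nonzero, the dual function does not decrease along d near l, and l + t d is
    a second dual optimum [unique_dual_direction]. Averaging x with the
    minimal points that occur in the conic combination gives a complementary
    feasible point of the required form, and such a point is optimal
    [complementary_lp_optimal].

    The step length t exists because finitely many points of X_i suffice to
    minimize all linear functions over X_i [finite_minimizers]. The argument
    breaks down without this polyhedral input: for general compact sets, a
    unique dual optimum does not force strict complementarity. *)

Set Implicit Arguments.
Unset Strict Implicit.
Unset Printing Implicit Defensive.

Import Order.TTheory GRing.Theory Num.Theory.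
Import numFieldNormedType.Exports.
Local Open Scope classical_set_scope.
Local Open Scope ring_scope.

(** * The scalar product *)

Lemma dotE (R : realType) n (u v : 'cV[R]_n) :
  dot u v = \sum_i u i 0 * v i 0.
Proof. by rewrite /dot mxE; apply: eq_bigr => i _; rewrite mxE. Qed.

Lemma dotC (R : realType) n (u v : 'cV[R]_n) : dot u v = dot v u.
Proof. by rewrite !dotE; apply: eq_bigr => i _; rewrite mulrC. Qed.

Fact dot_is_scalar (R : realType) n (u : 'cV[R]_n) : scalar (dot u).
Proof. by move=> a x y; rewrite /dot mulmxDr -scalemxAr !mxE. Qed.

HB.instance Definition _ (R : realType) n (u : 'cV[R]_n) :=
  GRing.isLinear.Build R 'cV[R]_n R _ (dot u) (@dot_is_scalar R n u).

Lemma dotDl (R : realType) n (u v w : 'cV[R]_n) :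
  dot (u + v) w = dot u w + dot v w.
Proof. by rewrite dotC linearD /= !(dotC w). Qed.

Lemma dotZl (R : realType) n a (u w : 'cV[R]_n) :
  dot (a *: u) w = a * dot u w.
Proof. by rewrite dotC linearZ /= (dotC w). Qed.

Lemma dotDr (R : realType) n (w u v : 'cV[R]_n) :
  dot w (u + v) = dot w u + dot w v.
Proof. exact: linearD. Qed.

Lemma dotZr (R : realType) n a (w u : 'cV[R]_n) :
  dot w (a *: u) = a * dot w u.
Proof. exact: linearZ. Qed.

Lemma dotNr (R : realType) n (w u : 'cV[R]_n) : dot w (- u) = - dot w u.
Proof. exact: linearN. Qed.

Lemma dotNl (R : realType) n (w u : 'cV[R]_n) : dot (- w) u = - dot w u.
Proof. by rewrite dotC dotNr dotC. Qed.

Lemma dot_delta (R : realType) n (w : 'cV[R]_n) k :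
  dot w (delta_mx k 0) = w k 0.
Proof.
rewrite dotE (bigD1 k) //= big1 => [|i ik]; rewrite mxE ?eqxx ?(negPf ik) /=.
  by rewrite addr0 mulr1.
by rewrite mulr0.
Qed.

Lemma dot_mulmx (R : realType) m n (l : 'cV[R]_m) (H : 'M[R]_(m, n)) x :
  dot l (H *m x) = dot (H^T *m l) x.
Proof. by rewrite /dot trmx_mul trmxK mulmxA. Qed.

Lemma ler_dot (R : realType) n (l u v : 'cV[R]_n) :
  lev 0 l -> lev u v -> dot l u <= dot l v.
Proof.
move=> l0 uv; rewrite !dotE; apply: ler_sum => i _; apply: ler_wpM2l => //.
by have := l0 i; rewrite mxE.
Qed.

(** * The lemma of Farkas and linear dependence *)

(** Induction on the number of generators, after Bartl; write <y, v> for the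
    scalar product and a0 for the first generator. If dropping a0 breaks the
    hypothesis, some z is nonnegative on the other generators and negative on c
    and on a0, and can be scaled so that <z, a0> = -1. Adding to each of the
    other vectors v the multiple <z, v> a0 makes it orthogonal to z, and the
    hypothesis for these new vectors at y is the old one at y + <y, a0> z, which
    is orthogonal to a0. *)
Lemma farkas_ord (R : realType) n m (a : 'I_n -> 'cV[R]_m) (c : 'cV[R]_m) :
  (forall y, (forall j, 0 <= dot y (a j)) -> 0 <= dot y c) ->
  exists p : 'I_n -> R, (forall j, 0 <= p j) /\ c = \sum_j p j *: a j.
Proof.
elim: n a c => [|n IHn] a c hc.
  exists (fun=> 0); split=> //; rewrite big_ord0.
  (* Without generators the hypothesis reads 0 <= <y, c> for every y. *)
  have /hc : forall j : 'I_0, 0 <= dot (- c) (a j) by case.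
  rewrite dotNl oppr_ge0 dotE => c_le0.
  have sq_ge0 i : true -> 0 <= c i 0 * c i 0 by rewrite -expr2 sqr_ge0.
  have /(psumr_eq0P sq_ge0) c0 : \sum_i c i 0 * c i 0 = 0.
    by apply/eqP; rewrite eq_le c_le0 sumr_ge0.
  apply/colP => i; rewrite mxE; apply/eqP.
  by have /eqP := c0 i isT; rewrite mulf_eq0 orbb.
pose a' j := a (lift ord0 j).
have [/IHn[p [p0 cE]]|] := pselect (forall y,
    (forall j, 0 <= dot y (a' j)) -> 0 <= dot y c).
  exists (fun i => if unlift ord0 i is Some j then p j else 0); split.
    by move=> i; case: unliftP => // j.
  rewrite big_ord_recl unlift_none scale0r add0r cE.
  by apply: eq_bigr => j _; rewrite liftK.
move=> /existsNP[z0 /not_implyP[z0a /negP]]; rewrite -ltNge => z0c.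
have z0a0 : dot z0 (a ord0) < 0.
  rewrite ltNge; apply/negP => z0a0; move: z0c; rewrite ltNge hc // => j.
  by case: (unliftP ord0 j) => [k ->|->] //; exact: z0a.
pose z := (- dot z0 (a ord0))^-1 *: z0.
have inv_gt0 : 0 < (- dot z0 (a ord0))^-1 by rewrite invr_gt0 oppr_gt0.
have za0 : dot z (a ord0) = -1.
  by rewrite dotZl invrN mulNr mulVf // lt_eqF.
have za j : 0 <= dot z (a' j) by rewrite dotZl mulr_ge0 // ltW.
have zc : dot z c < 0 by rewrite dotZl pmulr_rlt0.
have [|p [p0 cE]] := IHn (fun j => a' j + dot z (a' j) *: a ord0)
    (c + dot z c *: a ord0).
  move=> y ya.
  have /hc : forall j, 0 <= dot (y + dot y (a ord0) *: z) (a j).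
    move=> j; rewrite dotDl dotZl; case: (unliftP ord0 j) => [k|] ->.
      by have := ya k; rewrite dotDr dotZr mulrC.
    by rewrite za0 mulrN1 subrr.
  by rewrite dotDl dotZl dotDr dotZr mulrC.
exists (fun i => if unlift ord0 i is Some j then p j
                 else \sum_j p j * dot z (a' j) - dot z c); split.
  move=> i; case: unliftP => [j|] _ //.
  rewrite subr_ge0 (le_trans (ltW zc)) //.
  by apply: sumr_ge0 => j _; apply: mulr_ge0.
rewrite big_ord_recl unlift_none.
under [X in _ = _ + X]eq_bigr do rewrite liftK.
move/(canRL (addrK _)): cE => {1}->.
under [X in X - _]eq_bigr do rewrite scalerDr scalerA.
by rewrite big_split -scaler_suml scalerBl -addrA addrC.
Qed.

Lemma farkas (R : realType) (J : finType) m (P : pred J) (a : J -> 'cV[R]_m)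
    (c : 'cV[R]_m) :
  (forall y, (forall j, P j -> 0 <= dot y (a j)) -> 0 <= dot y c) ->
  exists p : J -> R, (forall j, 0 <= p j) /\ c = \sum_(j | P j) p j *: a j.
Proof.
move=> hc.
have [|p [p0 ->]] := @farkas_ord R #|J| m
    (fun i => if P (enum_val i) then a (enum_val i) else 0) c.
  move=> y ya; apply: hc => j Pj.
  by have := ya (enum_rank j); rewrite enum_rankK Pj.
exists (fun j => p (enum_rank j)); split=> //.
rewrite [RHS]big_mkcond [RHS](reindex _ (onW_bij _ (enum_val_bij J))) /=.
by apply: eq_bigr => i _; rewrite enum_valK; case: ifP => //; rewrite scaler0.
Qed.

(** The matrix with these vectors as rows has more rows than columns, so that
    its left kernel is nonzero. *)
Lemma linear_dependence (R : realType) (I : finType) m (g : I -> 'cV[R]_m)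
    (N : {set I}) : (m < #|N|)%N ->
  exists alpha : I -> R, (exists2 i, i \in N & alpha i != 0) /\
    \sum_(i in N) alpha i *: g i = 0.
Proof.
move=> mN; pose M := \matrix_(j < #|N|, k < m) g (enum_val j) k 0.
have : kermx M != 0.
  by rewrite kermx_eq0 -row_leq_rank -ltnNge (leq_ltn_trans _ mN) ?rank_leq_col.
move/rowV0Pn => [a /sub_kermxP aM /rV0Pn[j0 aj0]].
have N0 := enum_valP j0.
exists (fun i => a 0 (enum_rank_in N0 i)); split.
  by exists (enum_val j0); rewrite // enum_valK_in.
rewrite big_enum_val /=; apply/colP => k.
move/rowP/(_ k): aM; rewrite !mxE summxE => aM; rewrite -[RHS]aM.
by apply: eq_bigr => j _; rewrite !mxE enum_valK_in.
Qed.

(** * Convex sets and convex hulls *)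

Lemma convex_setP (R : realType) n (C : set 'cV[R]_n) :
  convex_set C <-> forall x y t, C x -> C y -> 0 <= t <= 1 ->
    C (t *: x + (1 - t) *: y).
Proof.
split=> [cvxC x y t Cx Cy t01|cvxC x y l /set_mem Cx /set_mem Cy].
  by have := cvxC x y (Itv01 (andP t01).1 (andP t01).2);
     rewrite !inE => /(_ Cx Cy).
by apply/mem_set; apply: cvxC => //; apply/andP; split.
Qed.

Lemma convex_conv_hull (R : realType) n (X : set 'cV[R]_n) :
  convex_set (conv_hull X).
Proof.
apply/convex_setP => x y t Xx Xy t01 C [cvxC XC].
by move/convex_setP: (cvxC); apply=> //; [exact: Xx | exact: Xy].
Qed.

Lemma conv_hull_dot_ge (R : realType) n (X : set 'cV[R]_n) w a :
  (forall x, X x -> a <= dot w x) -> forall x, conv_hull X x -> a <= dot w x.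
Proof.
move=> Xa; apply: (@smallest_sub _ _ X [set x | a <= dot w x]) => //.
apply/convex_setP => x y t /= ax ay /andP[t0 t1]; rewrite linearD !linearZ /=.
nra.
Qed.

(** Multiplying by the total weight instead of dividing by it covers the case of
    total weight zero, in which C has to be nonempty to supply y. *)
Lemma convex_nonneg_comb (R : realType) (J : finType) n (C : set 'cV[R]_n)
    (P : pred J) (p : J -> R) (v : J -> 'cV[R]_n) :
  convex_set C -> C !=set0 -> (forall j, 0 <= p j) ->
  (forall j, P j -> C (v j)) ->
  exists2 y, C y & \sum_(j | P j) p j *: v j = (\sum_(j | P j) p j) *: y.
Proof.
move=> /convex_setP cvxC [c0 Cc0] p0 Cv.
(* K is the cone over C: its elements s * y, paired with the scale s, are
   closed under addition, which is the induction step. *)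
pose K (s : R) x := 0 <= s /\ exists2 y, C y & x = s *: y.
suff [] : K (\sum_(j | P j) p j) (\sum_(j | P j) p j *: v j) by [].
apply: (big_ind2 K).
- by split=> //; exists c0; rewrite ?scale0r.
- move=> s x s' x' [s0 [y Cy ->]] [s'0 [y' Cy' ->]].
  split; first exact: addr_ge0.
  have [ss0|ss0] := eqVneq (s + s') 0.
    exists c0 => //; rewrite ss0 scale0r.
    have s_0 : s = 0 by lra.
    have s_1 : s' = 0 by lra.
    by rewrite s_0 s_1 !scale0r addr0.
  have ss_gt0 : 0 < s + s' by rewrite lt0r ss0 addr_ge0.
  exists ((s / (s + s')) *: y + (1 - s / (s + s')) *: y').
    apply: cvxC => //; apply/andP; split; first by rewrite divr_ge0 // ltW.
    by rewrite ler_pdivrMr // mul1r lerDl.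
  by rewrite scalerDr !scalerA; congr (_ *: _ + _ *: _); field.
- by move=> j Pj; split=> //; exists (v j) => //; apply: Cv.
Qed.

(** * Finitely many points minimize every linear function *)

(** The map e lists the coordinates that are required to be integers. *)
Definition mixed_polyhedron (R : realType) n z r (e : 'I_z -> 'I_n)
    (A : 'M[R]_(r, n)) (d : 'cV[R]_r) : set 'cV[R]_n :=
  [set x : 'cV[R]_n |
    (forall j, x (e j) 0 \is a Num.int) /\ lev (A *m x) d].

Definition active (R : realType) n r (A : 'M[R]_(r, n)) (d : 'cV[R]_r)
    (x : 'cV[R]_n) : {set 'I_r} :=
  [set k | (A *m x) k 0 == d k 0].

(** A rigid point is a vertex of its slice: no line through it preserves both
    its integer coordinates and its active constraints. *)
Definition rigid (R : realType) n z r (e : 'I_z -> 'I_n) (A : 'M[R]_(r, n))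
    (d : 'cV[R]_r) (x : 'cV[R]_n) : Prop :=
  forall w : 'cV[R]_n, (forall j, w (e j) 0 = 0) ->
    (forall k, k \in active A d x -> (A *m w) k 0 = 0) -> w = 0.

Lemma rigid_inj (R : realType) n z r (e : 'I_z -> 'I_n) (A : 'M[R]_(r, n))
    (d : 'cV[R]_r) (x y : 'cV[R]_n) :
  rigid e A d x -> active A d x = active A d y ->
  (forall j, x (e j) 0 = y (e j) 0) -> x = y.
Proof.
move=> rx axy xy; apply/eqP; rewrite -subr_eq0; apply/eqP; apply: rx.
  by move=> j; rewrite !mxE xy subrr.
move=> k kx; have ky := kx; rewrite axy in ky.
move: kx ky; rewrite !inE mulmxBr !mxE => /eqP -> /eqP ->.
by rewrite subrr.
Qed.

(** A non-rigid point has a line along which its integer coordinates and active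
    constraints stay fixed. Boundedness makes the point hit a new constraint
    when it moves along the line in the direction in which f does not
    increase. *)
Lemma more_active_point (R : realType) n z r (e : 'I_z -> 'I_n)
    (A : 'M[R]_(r, n)) (d : 'cV[R]_r) (B : R) (f x : 'cV[R]_n) :
  (forall y, mixed_polyhedron e A d y -> forall i, `|y i 0| <= B) ->
  mixed_polyhedron e A d x -> ~ rigid e A d x ->
  exists y, [/\ mixed_polyhedron e A d y, active A d x \proper active A d y &
    dot f y <= dot f x].
Proof.
move=> XB [xint xd] /existsNP[w0 /not_implyP[w0e /not_implyP[w0a w0_neq0]]].
have [w [we wa w_neq0 fw]] : exists w : 'cV[R]_n,
    [/\ forall j, w (e j) 0 = 0,
        forall k, k \in active A d x -> (A *m w) k 0 = 0, w != 0
      & dot f w <= 0].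
  move/eqP: w0_neq0 => w0_neq0.
  have [fw0|/ltW fw0] := lerP (dot f w0) 0; first by exists w0.
  exists (- w0); split; rewrite ?oppr_eq0 ?dotNr ?oppr_le0 //.
    by move=> j; rewrite mxE w0e oppr0.
  by move=> k kx; rewrite mulmxN mxE w0a ?oppr0.
have moveE s k : (A *m (x + s *: w)) k 0 = (A *m x) k 0 + s * (A *m w) k 0.
  by rewrite mulmxDr -scalemxAr !mxE.
have moveX s : lev (A *m (x + s *: w)) d -> mixed_polyhedron e A d (x + s *: w).
  by split=> // j; rewrite !mxE we mulr0 addr0.
(* Otherwise the whole half-line stays in the polyhedron; the parameter s below
   leads to a point with |x_i + s w_i| >= 1 + B. *)
have [k0 k0P] : exists k, 0 < (A *m w) k 0.
  apply: contrapT => /forallNP no_pos.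
  have [i wi] : exists i, w i 0 != 0.
    apply: contrapT => /forallNP w_eq0; case/eqP: w_neq0; apply/colP => i.
    by rewrite mxE; apply/eqP/negPn/negP/w_eq0.
  have wi_gt0 : 0 < `|w i 0| by rewrite normr_gt0.
  pose s := (1 + B + `|x i 0|) / `|w i 0|.
  have B0 : 0 <= B by apply: le_trans (XB x _ i) => //; split.
  have s0 : 0 <= s by rewrite divr_ge0 // !addr_ge0.
  have /XB/(_ i) : mixed_polyhedron e A d (x + s *: w).
    apply: moveX => k; rewrite moveE; apply: le_trans (xd k).
    rewrite gerDl mulr_ge0_le0 // leNgt; apply/negP; exact: no_pos.
  rewrite !mxE leNgt => /negP; apply.
  have : `|s * w i 0| = 1 + B + `|x i 0|.
    by rewrite normrM ger0_norm // divfK // gt_eqF.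
  have := ler_normB (x i 0 + s * w i 0) (x i 0).
  rewrite addrAC subrr add0r => + sE; rewrite sE; lra.
pose step k := (d k 0 - (A *m x) k 0) / (A *m w) k 0.
(* The constraint that is hit first. *)
case: (arg_minP (P := fun k => 0 < (A *m w) k 0) step k0P) => k kP k_min.
have s0 : 0 <= step k by rewrite divr_ge0 ?subr_ge0 // ltW.
exists (x + step k *: w); split.
- apply: moveX => l; rewrite moveE.
  have [wl|wl] := ltP 0 ((A *m w) l 0).
    by have := k_min _ wl; rewrite {2}/step ler_pdivlMr // lerBrDl.
  by apply: le_trans (xd l); rewrite gerDl mulr_ge0_le0.
- apply/properP; split.
    apply/fintype.subsetP => l lx; have := lx; rewrite !inE moveE (wa l lx) mulr0.
    by rewrite addr0.
  exists k; first by rewrite inE moveE /step divfK ?lt0r_neq0 // addrC subrK.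
  by apply/negP => /wa wk; move: kP; rewrite wk ltxx.
- by rewrite dotDr dotZr gerDl mulr_ge0_le0.
Qed.

Lemma rigid_point_below (R : realType) n z r (e : 'I_z -> 'I_n)
    (A : 'M[R]_(r, n)) (d : 'cV[R]_r) (B : R) (f x : 'cV[R]_n) :
  (forall y, mixed_polyhedron e A d y -> forall i, `|y i 0| <= B) ->
  mixed_polyhedron e A d x ->
  exists y, [/\ mixed_polyhedron e A d y, rigid e A d y & dot f y <= dot f x].
Proof.
move=> XB; have [N] := ubnP (r - #|active A d x|)%N.
elim: N x => // N IHN x; rewrite ltnS => xN Xx.
have [rx|nrx] := pselect (rigid e A d x); first by exists x.
have [y [Xy /proper_card xy fyx]] := more_active_point f XB Xx nrx.
have [|//|y' [Xy' ry' fy']] := IHN y.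
  have := max_card (mem (active A d y)); rewrite card_ord => yr.
  apply: leq_trans xN; rewrite ltn_sub2l //; exact: leq_trans xy yr.
by exists y'; split=> //; apply: le_trans fy' fyx.
Qed.

(** By [rigid_inj], a rigid point is determined by its active set and its
    integer coordinates, which take finitely many values as X is bounded; by
    [rigid_point_below], rigid points suffice to minimize. *)
Lemma finite_minimizers (R : realType) n z r (e : 'I_z -> 'I_n)
    (A : 'M[R]_(r, n)) (d : 'cV[R]_r) :
  let X := mixed_polyhedron e A d in
  X !=set0 -> compact X ->
  exists (T : finType) (V : T -> 'cV[R]_n), (forall t, X (V t)) /\
    forall f, exists t, forall x, X x -> dot f (V t) <= dot f x.
Proof.
move=> X [x0 Xx0] /compact_bounded/ex_bound.
move=> /(_ (globally_properfilter Xx0))[B0 B0P].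
have [B XB] : exists B : nat, forall y, X y -> forall i, `|y i 0| <= B%:R.
  exists (Num.truncn B0).+1 => y Xy i.
  apply: le_trans (ltW (truncnS_gt B0)); apply: le_trans (B0P _ Xy).
  rewrite [leRHS]/Num.norm /= mx_normrE; apply/bigmax_geP; right.
  by exists (i, 0).
(* Shifting by the bound B turns an integer in [-B, B] into a natural number at
   most 2 B. *)
pose code (x : 'cV[R]_n) : {set 'I_r} * {ffun 'I_z -> 'I_(B + B).+1} :=
  (active A d x, [ffun j => inord (Num.truncn (x (e j) 0 + B%:R))]).
have code_inj x y : X x -> X y -> rigid e A d x -> code x = code y -> x = y.
  move=> Xx Xy rx [axy /ffunP cxy]; apply: rigid_inj rx axy _ => j.
  have natB u : X u -> u (e j) 0 + B%:R \is a Num.nat.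
    move=> Xu; have [u_int _] := Xu.
    rewrite natrEint rpredD ?natr_int ?u_int //=.
    by have := XB _ Xu (e j); rewrite ler_norml -lerBlDr sub0r => /andP[].
  have truncB u : X u -> (Num.truncn (u (e j) 0 + B%:R)%R < (B + B).+1)%N.
    move=> Xu; rewrite ltnS -(ler_nat R) truncnK ?natB // natrD lerD2r.
    exact: le_trans (ler_norm _) (XB _ Xu _).
  have /= := congr1 val (cxy j); rewrite !ffunE !inordK ?truncB // => cE.
  have := congr1 (fun k : nat => k%:R : R) cE; rewrite !truncnK ?natB //.
  exact: addIr.
(* Codes that no rigid point has are sent to the arbitrary point x0. *)
pose good t x := [/\ X x, rigid e A d x & code x = t].
pose V t := xget x0 (good t).
have VX t : X (V t) by rewrite /V; case: xgetP => [x _ []|].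
have V_code x : X x -> rigid e A d x -> V (code x) = x.
  move=> Xx rx; rewrite /V; case: xgetP => [y _ [Xy ry yx]|/(_ x) []] //.
  exact: code_inj.
exists _, V; split=> // f.
case: (arg_minP (P := xpredT) (fun t => dot f (V t)) (i0 := code x0)) => //.
move=> t _ t_min; exists t => x Xx.
have [y [Xy ry fyx]] := rigid_point_below f XB Xx.
by apply: le_trans fyx; rewrite -(V_code y) // t_min.
Qed.

(** * Elementary facts on minima *)

(** The step is 1 / s with s >= |b k| / a k for all k; the convention x / 0 = 0
    discards the k with a k = 0 from the sum. *)
Lemma small_step (R : realType) (K : finType) (a b : K -> R) :
  (forall k, 0 <= a k) -> (forall k, a k = 0 -> 0 <= b k) ->
  exists2 t, 0 < t & forall k, 0 <= a k + t * b k.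
Proof.
move=> a0 b0; pose s := 1 + \sum_k `|b k| / a k.
have q0 k : 0 <= `|b k| / a k by rewrite divr_ge0.
have s0 : 0 < s by rewrite ltr_pwDl // sumr_ge0.
exists s^-1; first by rewrite invr_gt0.
move=> k; have [ak0|ak0] := eqVneq (a k) 0.
  by rewrite ak0 add0r mulr_ge0 ?b0 // invr_ge0 ltW.
have ak_gt0 : 0 < a k by rewrite lt0r ak0 a0.
have : `|b k| / a k <= s.
  by rewrite /s (bigD1 k) //= addrCA lerDl addr_ge0 // sumr_ge0.
rewrite ler_pdivrMr // -ler_pdivrMl // => bas.
have : - (s^-1 * b k) <= s^-1 * `|b k|.
  by rewrite -mulrN ler_pM2l ?invr_gt0 // lerNl lerNnormlW.
lra.
Qed.

Lemma inf_argmin (R : realType) (T : Type) (S : set T) (f : T -> R) x :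
  argmin S f x -> inf [set f y | y in S] = f x.
Proof.
move=> [Sx xmin]; have lbS : lbound [set f y | y in S] (f x).
  by move=> _ [y Sy <-]; apply: xmin.
apply/eqP; rewrite eq_le; apply/andP; split.
  by apply: ge_inf; [exists (f x) | exists x].
by apply: lb_le_inf => //; exists (f x), x.
Qed.

Lemma sup_argmax (R : realType) (T : Type) (S : set T) (f : T -> R) x :
  argmax S f x -> sup [set f y | y in S] = f x.
Proof.
move=> [Sx xmax]; have ubS : ubound [set f y | y in S] (f x).
  by move=> _ [y Sy <-]; apply: xmax.
apply/eqP; rewrite eq_le; apply/andP; split.
  by apply: ge_sup => //; exists (f x), x.
by apply: ub_le_sup; [exists (f x) | exists x].
Qed.

Lemma convex_argmin (R : realType) n (C : set 'cV[R]_n) f :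
  convex_set C -> convex_set (argmin C (dot f)).
Proof.
move=> /convex_setP cvxC; apply/convex_setP => x y t [Cx xmin] [Cy ymin] t01.
split=> [|z Cz]; first exact: cvxC.
rewrite dotDr !dotZr; have := xmin z Cz; have := ymin z Cz; move: t01.
by move=> /andP[t0 t1]; nra.
Qed.

Lemma argmin_conv_hull (R : realType) n (X : set 'cV[R]_n) f :
  argmin X (dot f) `<=` argmin (conv_hull X) (dot f).
Proof.
move=> x [Xx xmin]; split; first exact: sub_gen_smallest.
exact: conv_hull_dot_ge.
Qed.

(** * Lagrangian duality *)

Lemma lagrangian_dot (R : realType) (I : finType) m (P : milp R I m) l i :
  lagrangian P l i = dot (obj P i + (coupling P i)^T *m l).
Proof.
by apply/funext => x; rewrite dotDl -dot_mulmx.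
Qed.

Lemma sum_lagrangian (R : realType) (I : finType) m (P : milp R I m) l x :
  \sum_i lagrangian P l i (x i) = cost P x + dot l (usage P x).
Proof. by rewrite big_split /usage raddf_sum. Qed.

Lemma usage_comb (R : realType) (I : finType) m (P : milp R I m) a b x y :
  usage P (fun i => a *: x i + b *: y i) = a *: usage P x + b *: usage P y.
Proof.
rewrite /usage !scaler_sumr -big_split; apply: eq_bigr => i _.
by rewrite mulmxDr !scalemxAr.
Qed.

Lemma dual_function_argmin (R : realType) (I : finType) m (P : milp R I m)
    u l x :
  (forall i, argmin (local_set P i) (lagrangian P l i) (x i)) ->
  dual_function P u l = \sum_i lagrangian P l i (x i) - dot l u.
Proof.
move=> xmin; rewrite /dual_function addrC; congr (_ - _).
by apply: eq_bigr => i _; rewrite (inf_argmin (xmin i)).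
Qed.

(** Minimizing over conv(X_i) instead of X_i does not change the minimum, and
    makes the set of minimizers convex, so that points can be averaged and
    pushed within it. *)
Definition lagrangian_face (R : realType) (I : finType) m (P : milp R I m) l i
    : set 'cV[R]_(nreal P i + nint P i) :=
  argmin (conv_hull (local_set P i)) (lagrangian P l i).
Arguments lagrangian_face {R I m} P l i _.

Lemma convex_lagrangian_face (R : realType) (I : finType) m (P : milp R I m)
  l i : convex_set (lagrangian_face P l i).
Proof.
rewrite /lagrangian_face lagrangian_dot; apply: convex_argmin.
exact: convex_conv_hull.
Qed.

Lemma argmin_lagrangian_face (R : realType) (I : finType) m (P : milp R I m)
  l i : argmin (local_set P i) (lagrangian P l i) `<=` lagrangian_face P l i.
Proof. by rewrite /lagrangian_face lagrangian_dot; apply: argmin_conv_hull. Qed.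

(** Complementary slackness makes the cost of y equal to its Lagrangian value, a
    lower bound for the cost of every feasible point. *)
Lemma complementary_lp_optimal (R : realType) (I : finType) m
    (P : milp R I m) u l y :
  lev 0 l -> (forall i, lagrangian_face P l i (y i)) ->
  lev (usage P y) u -> (forall k, l k 0 != 0 -> usage P y k 0 = u k 0) ->
  lp_optimal P u y.
Proof.
move=> l0 yface yu ycompl; split.
  by split=> // i; have [] := yface i.
move=> w [wu wX].
have yE : dot l (usage P y) = dot l u.
  rewrite !dotE; apply: eq_bigr => k _.
  have [->|/ycompl -> //] := eqVneq (l k 0) 0.
  by rewrite !mul0r.
have : \sum_i lagrangian P l i (y i) <= \sum_i lagrangian P l i (w i).
  by apply: ler_sum => i _; have [_] := yface i; apply.
rewrite !sum_lagrangian yE; have := ler_dot l0 wu; lra.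
Qed.

Lemma local_minimizers (R : realType) (I : finType) m (P : milp R I m) i :
  local_set P i !=set0 -> compact (local_set P i) ->
  exists (T : finType) (V : T -> 'cV[R]_(nreal P i + nint P i)),
    (forall t, local_set P i (V t)) /\
    forall f, exists t, forall x, local_set P i x -> dot f (V t) <= dot f x.
Proof. exact: finite_minimizers. Qed.

(** Tuples of block minimizers. A finite family in the product turns the dual
    function into the minimum of finitely many affine functions of l. *)
Lemma product_minimizers (R : realType) (I : finType) m (P : milp R I m) :
  (forall i, local_set P i !=set0) -> (forall i, compact (local_set P i)) ->
  exists (J : finType) (V : J -> forall i, 'cV[R]_(nreal P i + nint P i)),
    (forall j i, local_set P i (V j i)) /\
    forall l, exists j, forall i,
      argmin (local_set P i) (lagrangian P l i) (V j i).
Proof.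
move=> X_neq0 X_compact.
pose T i := cid (local_minimizers (X_neq0 i) (X_compact i)).
pose V i := cid (projT2 (T i)).
have VX i := (projT2 (V i)).1; have Vmin i := (projT2 (V i)).2.
exists {dffun forall i, projT1 (T i)}.
exists (fun (j : {dffun forall i, projT1 (T i)}) i => projT1 (V i) (j i)).
split=> [j i|l]; first exact: VX.
have [j jP] : exists j : forall i, projT1 (T i), forall i x, local_set P i x ->
    lagrangian P l i (projT1 (V i) (j i)) <= lagrangian P l i x.
  pose j i := cid (Vmin i (obj P i + (coupling P i)^T *m l)).
  exists (fun i => projT1 (j i)) => i; rewrite lagrangian_dot.
  exact: projT2 (j i).
by exists [ffun i => j i] => i; rewrite ffunE; split; [exact: VX | exact: jP].
Qed.

(** The dual function is the minimum over j of affine functions with slopes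
    usage (V j) - u. Those that attain the minimum at l do not decrease along d,
    and the finitely many others leave room for a small step, as do the positive
    coordinates of l. Thus l + t d is dual optimal for some t > 0, and
    uniqueness forces d = 0. *)
Lemma unique_dual_direction (R : realType) (I J : finType) m (P : milp R I m)
    u l (x : forall i, 'cV[R]_(nreal P i + nint P i))
    (V : J -> forall i, 'cV[R]_(nreal P i + nint P i)) (d : 'cV[R]_m) :
  dual_optimal P u l -> (forall l', dual_optimal P u l' -> l = l') ->
  (forall i, argmin (local_set P i) (lagrangian P l i) (x i)) ->
  (forall j i, local_set P i (V j i)) ->
  (forall l', exists j, forall i,
     argmin (local_set P i) (lagrangian P l' i) (V j i)) ->
  (forall j, (forall i, lagrangian_face P l i (V j i)) ->
     0 <= dot d (usage P (V j) - u)) ->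
  (forall k, l k 0 = 0 -> 0 <= d k 0) ->
  d = 0.
Proof.
move=> [l0 lmax] luniq xmin VX Vmin dV dl.
pose gap j i := lagrangian P l i (V j i) - lagrangian P l i (x i).
have gap0 j i : 0 <= gap j i by rewrite subr_ge0; have [_] := xmin i; apply.
pose a (s : J + 'I_m) :=
  match s with inl j => \sum_i gap j i | inr k => l k 0 end.
pose b (s : J + 'I_m) :=
  match s with inl j => dot d (usage P (V j) - u) | inr k => d k 0 end.
have [||t t0 tP] := @small_step R _ a b.
- case=> [j|k] /=; first exact: sumr_ge0.
  by have := l0 k; rewrite mxE.
- case=> [j|k] /=; last exact: dl.
  move=> gap_eq0; apply: dV => i.
  have /eqP := psumr_eq0P (fun i _ => gap0 j i) gap_eq0 (i := i) isT.
  rewrite subr_eq0 => /eqP Vx; have [xX xle] := argmin_lagrangian_face (xmin i).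
  by split=> [|y Xy]; [exact: sub_gen_smallest | rewrite Vx xle].
have /luniq ltd : dual_optimal P u (l + t *: d).
  split=> [k|l' /lmax l'l].
    by have := tP (inr k); rewrite !mxE.
  apply: le_trans l'l _; have [j jmin] := Vmin (l + t *: d).
  rewrite (dual_function_argmin u jmin) (dual_function_argmin u xmin).
  have := tP (inl j); rewrite /= sumrB !sum_lagrangian !dotDl !dotZl dotDr dotNr.
  lra.
have := congr1 (fun v => v - l) ltd; rewrite subrr addrC addKr => /esym/eqP.
by rewrite scaler_eq0 gt_eqF //= => /eqP.
Qed.

(** The uniqueness of the dual optimum l makes every profile x of block
    minimizers at l part, with positive weight e, of some feasible
    complementary point. With u - usage x = sum_j p_j (usage (V j) - u) + q from Farkas and
    th = sum_j p_j, the point is (x + sum_j p_j V j) / (1 + th), whose usage is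
    u - q / (1 + th); thus q is the slack, up to scaling. *)
Lemma strict_complementarity (R : realType) (I : finType) m (P : milp R I m)
    u l (x : forall i, 'cV[R]_(nreal P i + nint P i)) :
  (forall i, local_set P i !=set0) -> (forall i, compact (local_set P i)) ->
  dual_optimal P u l -> (forall l', dual_optimal P u l' -> l = l') ->
  (forall i, argmin (local_set P i) (lagrangian P l i) (x i)) ->
  exists e y, let xbar := fun i => e *: x i + (1 - e) *: y i in
    [/\ 0 < e <= 1, forall i, lagrangian_face P l i (y i),
        lev (usage P xbar) u &
        forall k, l k 0 != 0 -> usage P xbar k 0 = u k 0].
Proof.
move=> X_neq0 X_compact lopt luniq xmin.
have [J [V [VX Vmin]]] := product_minimizers X_neq0 X_compact.
pose opt j := `[< forall i, lagrangian_face P l i (V j i) >].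
pose gen (s : J + 'I_m) : 'cV[R]_m :=
  match s with inl j => usage P (V j) - u | inr k => delta_mx k 0 end.
pose sel (s : J + 'I_m) :=
  match s with inl j => opt j | inr k => l k 0 == 0 end.
have [d dP|p [p0]] := @farkas R _ m sel gen (u - usage P x).
  suff -> : d = 0 by rewrite dotC linear0.
  apply: (unique_dual_direction lopt luniq xmin VX Vmin).
    by move=> j jopt; apply: (dP (inl j)); apply/asboolP.
  by move=> k lk; have := dP (inr k); rewrite /= dot_delta lk eqxx; apply.
rewrite big_sumType /=; set q := (X in _ = _ + X) => ux.
have qE k : q k 0 = \sum_(k' | l k' 0 == 0) p (inr k') * (k == k')%:R.
  by rewrite /q summxE; apply: eq_bigr => k' _; rewrite !mxE andbT.
have q0 k : 0 <= q k 0.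
  by rewrite qE; apply: sumr_ge0 => k' _; rewrite mulr_ge0.
have q_compl k : l k 0 != 0 -> q k 0 = 0.
  move=> lk; rewrite qE big1 // => k' lk'; case: eqP => [kk'|_].
    by move: lk; rewrite kk' lk'.
  by rewrite mulr0.
have xface i : lagrangian_face P l i (x i) by apply: argmin_lagrangian_face.
pose th := \sum_(j | opt j) p (inl j).
have th0 : 0 <= th by apply: sumr_ge0.
have y_ex i : exists2 y, lagrangian_face P l i y &
    \sum_(j | opt j) p (inl j) *: V j i = th *: y.
  apply: convex_nonneg_comb => //; first exact: convex_lagrangian_face.
    by exists (x i).
  by move=> j /asboolP.
pose y i := s2val (cid2 (y_ex i)).
have yface i : lagrangian_face P l i (y i) := s2valP (cid2 (y_ex i)).
have yE i : \sum_(j | opt j) p (inl j) *: V j i = th *: y i :=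
  s2valP' (cid2 (y_ex i)).
have usage_y :
    \sum_(j | opt j) p (inl j) *: (usage P (V j) - u) = th *: (usage P y - u).
  under eq_bigr do rewrite scalerBr.
  rewrite sumrB -scaler_suml -/th scalerBr; congr (_ - _).
  rewrite /usage scaler_sumr; under eq_bigr do rewrite scaler_sumr.
  rewrite exchange_big; apply: eq_bigr => i _ /=.
  rewrite scalemxAr -yE mulmx_sumr; apply: eq_bigr => j _.
  by rewrite scalemxAr.
have th1 : 0 < 1 + th by rewrite ltr_pwDl.
pose e := (1 + th)^-1.
have e0 : 0 < e by rewrite invr_gt0.
have e1 : e <= 1 by rewrite invf_le1 // lerDl.
have eE : 1 - e = e * th.
  by rewrite /e; field; rewrite gt_eqF.
have usage_e :
    usage P (fun i => e *: x i + (1 - e) *: y i) = u - e *: q.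
  rewrite usage_comb eE; apply/colP => k.
  move/colP/(_ k): ux; rewrite usage_y !mxE => ux.
  have -> : q k 0 = u k 0 - usage P x k 0 - th * (usage P y k 0 - u k 0).
    by rewrite ux; ring.
  by rewrite /e; field; rewrite gt_eqF.
exists e, y; split=> //; first by rewrite e0.
- by move=> k; rewrite usage_e !mxE gerBl mulr_ge0 // ltW.
- by move=> k lk; rewrite usage_e !mxE q_compl // mulr0 subr0.
Qed.

(** * Counting the blocks that differ and bounding the excess *)

(** With more than m differing blocks, a linear dependence among the
    H_i (x_i - xbar_i) gives a push of xbar that keeps the resource usage. The
    push stays in the Lagrangian faces because x_i has weight e > 0 in
    xbar_i. *)
Lemma card_moved_blocks_le (R : realType) (I : finType) m (P : milp R I m) u l e
    (x y : forall i, 'cV[R]_(nreal P i + nint P i)) :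
  let xbar := fun i => e *: x i + (1 - e) *: y i in
  lev 0 l -> 0 < e <= 1 ->
  (forall i, lagrangian_face P l i (x i)) ->
  (forall i, lagrangian_face P l i (y i)) ->
  lev (usage P xbar) u -> (forall k, l k 0 != 0 -> usage P xbar k 0 = u k 0) ->
  (forall z, lp_optimal P u z -> xbar = z) ->
  (#|[set i | x i != xbar i]%SET| <= m)%N.
Proof.
move=> xbar l0 /andP[e0 e1] xface yface bar_le bar_compl bar_uniq.
rewrite leqNgt; apply/negP => mN.
have [al [[i0 i0N al0]]] :=
  linear_dependence (fun i => coupling P i *m (x i - xbar i)) mN.
rewrite big_mkcond => al_dep.
have {}al_dep : \sum_i al i *: (coupling P i *m (x i - xbar i)) = 0.
  rewrite -[RHS]al_dep; apply: eq_bigr => i _; rewrite inE.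
  case: ifPn => //; rewrite negbK => /eqP <-.
  by rewrite subrr mulmx0 scaler0.
(* The scaling by t bounds all the coefficients of the push by e. *)
pose s := 1 + \sum_i `|al i|.
have s0 : 0 < s by rewrite ltr_pwDl // sumr_ge0.
pose t := e / s.
have t0 : 0 < t by rewrite divr_gt0.
have t_al i : `|t * al i| <= e.
  rewrite normrM gtr0_norm // /t mulrAC ler_pdivrMr //.
  apply: ler_wpM2l; first exact: ltW.
  by rewrite /s (bigD1 i) //= addrCA lerDl addr_ge0 // sumr_ge0.
pose z i := xbar i + (t * al i) *: (x i - xbar i).
have usage_z : usage P z = usage P xbar.
  rewrite /usage /z; under eq_bigr do rewrite mulmxDr -scalemxAr -scalerA.
  by rewrite big_split /= -scaler_sumr al_dep scaler0 addr0.
have zface i : lagrangian_face P l i (z i).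
  have -> : z i = (e + t * al i * (1 - e)) *: x i +
                  (1 - (e + t * al i * (1 - e))) *: y i.
    by apply/colP => k; rewrite !mxE; ring.
  have /convex_setP := @convex_lagrangian_face _ _ _ P l i; apply=> //.
  have := t_al i; rewrite ler_norml; move: (t * al i) => c /andP[c1 c2].
  have lo : 0 <= (c + e) * (1 - e) by apply: mulr_ge0; lra.
  have hi : 0 <= (e - c) * (1 - e) by apply: mulr_ge0; lra.
  have := sqr_ge0 e; have := sqr_ge0 (1 - e); rewrite !expr2 => sq1 sq2.
  by apply/andP; split; lra.
have /bar_uniq/(congr1 (fun f => f i0)) : lp_optimal P u z.
  by apply: (complementary_lp_optimal l0 zface); rewrite usage_z.
move/esym/eqP; rewrite /z -subr_eq0 addrC addKr scaler_eq0 mulf_eq0.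
rewrite gt_eqF // (negPf al0) subr_eq0 /= => /eqP xbarE.
by move: i0N; rewrite inE xbarE eqxx.
Qed.

Lemma row_mulmx_dot (R : realType) m n (H : 'M[R]_(m, n)) k (x : 'cV[R]_n) :
  (row k H *m x) 0 0 = dot (row k H)^T x.
Proof. by rewrite /dot trmxK. Qed.

(** Passing to the convex hull does not enlarge the range of a linear
    function. *)
Lemma coupling_range_ge (R : realType) (I : finType) m (P : milp R I m) k i
    x y :
  local_set P i !=set0 -> compact (local_set P i) ->
  local_set P i x -> conv_hull (local_set P i) y ->
  (coupling P i *m (x - y)) k 0 <= coupling_range P k i.
Proof.
move=> X_neq0 X_compact Xx Xy; pose h := (row k (coupling P i))^T.
have [T [V [VX Vmin]]] := local_minimizers X_neq0 X_compact.
have hE : (fun v : 'cV_(nreal P i + nint P i) =>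
    (row k (coupling P i) *m v) 0 0) = dot h.
  by apply/funext => v; rewrite row_mulmx_dot.
have [t tmin] := Vmin h; have [s smin] := Vmin (- h).
have infE : inf (dot h @` local_set P i) = dot h (V t).
  by apply: inf_argmin; split.
have supE : sup (dot h @` local_set P i) = dot h (V s).
  by apply: sup_argmax; split=> // v /smin; rewrite !dotNl lerN2.
rewrite /coupling_range hE infE supE.
have -> : (coupling P i *m (x - y)) k 0 = dot h x - dot h y.
  by rewrite -!row_mulmx_dot mulmxBr -!row_mul !mxE.
have := smin _ Xx; rewrite !dotNl lerN2 => xs.
by have := conv_hull_dot_ge tmin Xy; lra.
Qed.

Theorem theorem3p1 (R : realType) (I : finType) (m : nat) (P : milp R I m)
  (m_gt0 : (0 < m)%N) (I_gt_m : (m < #|I|)%N)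
  (X_neq0 : forall i, local_set P i !=set0)
  (X_compact : forall i, compact (local_set P i))
  (P_feasible : feasible P !=set0)
  (lp_unique : exists! x, lp_optimal P (resource P - rho P) x)
  (dual_unique : exists! lambda, dual_optimal P (resource P - rho P) lambda)
  (lambdastar : 'cV[R]_m)
  (lambdastar_optimal : dual_optimal P (resource P - rho P) lambdastar) :
  forall x : (forall i, 'cV[R]_(nreal P i + nint P i)),
    selections P lambdastar x -> feasible P x.
Proof.
move=> x xsel; set u := resource P - rho P in lambdastar_optimal *.
have xmin i : argmin (local_set P i) (lagrangian P lambdastar i) (x i).
  by have [] := xsel i.
have xX i : local_set P i (x i) by have [] := xmin i.
have luniq l' : dual_optimal P u l' -> lambdastar = l'.
  case: dual_unique => l1 [_ l1uniq] l'opt.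
  by rewrite -(l1uniq _ lambdastar_optimal) (l1uniq _ l'opt).
have [e [y [e01 yface]]] :=
  strict_complementarity X_neq0 X_compact lambdastar_optimal luniq xmin.
set xbar := fun i => _ => bar_le bar_compl.
have l0 : lev 0 lambdastar by case: lambdastar_optimal.
have xface i : lagrangian_face P lambdastar i (x i).
  exact: argmin_lagrangian_face.
have barface i : lagrangian_face P lambdastar i (xbar i).
  have /convex_setP := @convex_lagrangian_face _ _ _ P lambdastar i; apply=> //.
  by case/andP: e01 => /ltW -> ->.
have bar_opt : lp_optimal P u xbar.
  exact: complementary_lp_optimal l0 barface bar_le bar_compl.
have bar_uniq z : lp_optimal P u z -> xbar = z.
  case: lp_unique => x1 [_ x1uniq] zopt.
  by rewrite -(x1uniq _ bar_opt) (x1uniq _ zopt).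
pose N := [set i | x i != xbar i]%SET.
have Nm : (#|N| <= m)%N.
  exact: card_moved_blocks_le l0 e01 xface yface bar_le bar_compl bar_uniq.
split=> // k.
pose s := sup [set coupling_range P k i | i in [set: I]].
have range_s i : coupling_range P k i <= s.
  apply: ub_le_sup; last by exists i.
  exists (\sum_i `|coupling_range P k i|) => _ [j _ <-].
  by rewrite (bigD1 j) //= (le_trans (ler_norm _)) // lerDl sumr_ge0.
have moved_le i : (coupling P i *m (x i - xbar i)) k 0 <= s.
  apply: le_trans (range_s i); apply: coupling_range_ge => //.
  by have [] := barface i.
have s0 : 0 <= s.
  have /card_gt0P[i _] : (0 < #|I|)%N by apply: leq_ltn_trans I_gt_m.
  apply: le_trans (range_s i).
  have := @coupling_range_ge _ _ _ P k i (x i) (x i) (X_neq0 i) (X_compact i)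
    (xX i) (@sub_gen_smallest _ _ _ _ (xX i)).
  by rewrite subrr mulmx0 mxE.
have -> : usage P x k 0 =
    usage P xbar k 0 + \sum_(i in N) (coupling P i *m (x i - xbar i)) k 0.
  rewrite /usage !summxE [X in _ + X]big_mkcond -big_split.
  apply: eq_bigr => i _; rewrite inE mulmxBr !mxE.
  by case: eqP => [<-|_] /=; rewrite ?addr0 // addrC subrK.
have : \sum_(i in N) (coupling P i *m (x i - xbar i)) k 0 <= m%:R * s.
  apply: le_trans (ler_sum _ (fun i _ => moved_le i)) _.
  by rewrite sumr_const -[s *+ _]mulr_natl ler_wpM2r // ler_nat.
by have := bar_le k; rewrite !mxE -/s; lra.
Qed.
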